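(* Let $n\ge 1$ and $s\ge 0$ be integers. If $2s\le n$, then $$\binom{n}{2s}=\sum_{m=0}^{n-2s}\binom{n-s-m}{s}\binom{m+s-1}{m}.$$ If $2s+1\le n$, then $$\binom{n}{2s+1}=\sum_{m=0}^{n-2s-1}\binom{n-s-m-1}{s}\binom{m+s}{m}.$$
   Context: Convention: $\binom{-1}{0}=1$ (this occurs only for $s=0$, $m=0$ in the first identity), and $\binom{p}{q}=0$ for integers $q>p\ge 0$. *)

(* Defs.v *)
From mathcomp Require Import all_boot.

(* On nat, ['C(m + s - 1, m)] is a genuine subtraction unless m = s = 0, where
   truncation gives ['C(0, 0)] = 1, i.e. the convention binom(-1, 0) = 1.
   ['C(p, q)] = 0 for q > p is the library's own convention. *)

(* Main.v *)
Require Import Defs.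
From mathcomp Require Import all_boot zify.

(** Both identities are instances of one convolution: since
    [(1 - x)^-(a + 1) = \sum_k 'C(a + k, a) x^k] and
    [(1 - x)^-b = \sum_m 'C(m + b - 1, m) x^m], comparing the coefficients of
    [x^N] in [(1 - x)^-(a + 1) * (1 - x)^-b = (1 - x)^-(a + b + 1)] gives
    [\sum_(m <= N) 'C(a + N - m, a) * 'C(m + b - 1, m) = 'C(a + b + N, a + b)].
    This is [bin_convolution]. The even identity is the case [a = b = s],
    [N = n - 2 * s]; the odd one is the case [a = s], [b = s + 1],
    [N = n - 2 * s - 1].

    The convolution itself needs no power series. Multiplication by
    [(1 - x)^-1] means taking partial sums, so both sides, as functions of
    [b] and [N], obey the Pascal recurrence
    [f (b + 1) (N + 1) = f b (N + 1) + f (b + 1) N], and they agree for [b = 0]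
    and for [N = 0]. *)

(** Starting from [b = 0] rather than [b = 1] makes the base case immediate:
    the second factor is then the coefficient sequence of the constant series
    [1], the convention binom(-1, 0) = 1 included. *)
Lemma bin_convolution a b N :
  \sum_(0 <= m < N.+1) 'C(a + N - m, a) * 'C(m + b - 1, m) = 'C(a + b + N, a + b).
Proof.
elim: b N => [|b IHb] N.
  rewrite big_nat_recl // big1 => [|m _].
    by rewrite !addn0 subn0 bin0 muln1.
  by rewrite [X in _ * X]bin_small ?muln0; lia.
elim: N => [|N IHN].
  by rewrite big_nat1 !addn0 subn0 bin0 !binn.
have -> : 'C(a + b.+1 + N.+1, a + b.+1) =
          'C(a + b + N.+1, a + b) + 'C(a + b.+1 + N, a + b.+1).
  by rewrite !addnS !addSn binS addnC.
rewrite -IHb -IHN.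
(* Pascal's rule splits every term but that of m = 0, which stays with the
   sum for b because both second factors are 1 there. *)
rewrite big_nat_recl // [in RHS]big_nat_recl // !bin0 -addnA; congr (_ + _).
rewrite -big_split; apply: eq_bigr => m _ /=.
have -> : a + N.+1 - m.+1 = a + N - m by lia.
have -> : m.+1 + b.+1 - 1 = (m + b).+1 by lia.
have -> : m.+1 + b - 1 = m + b by lia.
have -> : m + b.+1 - 1 = m + b by lia.
by rewrite binS mulnDr.
Qed.

Theorem corollary4p3 (n s : nat) (hn : 1 <= n) :
  (2 * s <= n ->
     'C(n, 2 * s) =
     \sum_(0 <= m < (n - 2 * s).+1) 'C(n - s - m, s) * 'C(m + s - 1, m)) /\
  (2 * s + 1 <= n ->
     'C(n, 2 * s + 1) =
     \sum_(0 <= m < (n - 2 * s - 1).+1) 'C(n - s - m - 1, s) * 'C(m + s, m)).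
Proof.
split=> le_n.
  have := bin_convolution s s (n - 2 * s).
  have -> : s + s + (n - 2 * s) = n by lia.
  have -> : s + s = 2 * s by lia.
  by move=> <-; apply: eq_bigr => m _; congr ('C(_, _) * _); lia.
have := bin_convolution s s.+1 (n - 2 * s - 1).
have -> : s + s.+1 + (n - 2 * s - 1) = n by lia.
have -> : s + s.+1 = 2 * s + 1 by lia.
by move=> <-; apply: eq_bigr => m _; congr ('C(_, _) * 'C(_, _)); lia.
Qed.
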